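(* Let $X$ be a multi-Bernoulli random finite set on $\mathbb{X}$ with $M$ components, with existence probabilities $r^{1},\dots,r^{M}\in[0,1)$ and single-object probability density functions $p^{1},\dots,p^{M}$ on $\mathbb{X}$, i.e. with multi-object density $$f(\{\mathbf{x}_1,\dots,\mathbf{x}_n\})=\prod_{i=1}^{M}(1-r^{i})\ \sum_{1\le i_1\neq\cdots\neq i_n\le M}\ \prod_{k=1}^{n}\frac{r^{i_k}\,p^{i_k}(\mathbf{x}_k)}{1-r^{i_k}},$$ where the sum is over all ordered $n$-tuples of pairwise distinct indices in $\mathbb{N}_M=\{1,\dots,M\}$ (so $f=0$ when $n>M$). Let $\mathcal{S}$ be a field-of-view. Then the number of objects inside $\mathcal{S}$ is distributed according to the probability mass function $$\rho_{\mathcal{S}}(n)=\prod_{i=1}^{M}(1-r^{i})\ \sum_{\mathcal{I}_1\uplus\mathcal{I}_2\subseteq\mathbb{N}_M}\delta_{n}(|\mathcal{I}_1|)\ \prod_{i\in\mathcal{I}_1}\frac{\langle 1_{\mathcal{S}},\,r^{i}p^{i}\rangle}{1-r^{i}}\ \prod_{i\in\mathcal{I}_2}\frac{\langle 1-1_{\mathcal{S}},\,r^{i}p^{i}\rangle}{1-r^{i}},$$ where the sum is over all ordered pairs $(\mathcal{I}_1,\mathcal{I}_2)$ of disjoint (possibly empty) sets with $\mathcal{I}_1\cup\mathcal{I}_2\subseteq\mathbb{N}_M$.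
   Context: The single-object state space is $\mathbb{X}=\mathbb{X}_s\times\mathbb{X}_v\subseteq\mathbb{R}^{n_x}$, with $\mathbb{X}_s\subseteq\mathbb{R}^{n_s}$ (e.g. position space) and $\mathbb{X}_v$ the remaining state components. A field-of-view is a compact subset $\mathcal{S}$ of $\mathbb{X}_s$. For $\mathbf{x}\in\mathbb{X}$ with $\mathbb{X}_s$-component $\mathbf{s}$, the generalized indicator is $1_{\mathcal{S}}(\mathbf{x})=1$ if $\mathbf{s}\in\mathcal{S}$ and $0$ otherwise. For integrable functions, $\langle f,g\rangle=\int_{\mathbb{X}} f(\mathbf{x})g(\mathbf{x})\,\mathrm{d}\mathbf{x}$. $\delta_a(b)$ is the Kronecker delta ($1$ if $a=b$, else $0$). All functions are measurable, and empty products equal $1$. A multi-object density is a function $f$ on finite subsets of $\mathbb{X}$, integrated by the set integral $$\int g(X)\,\delta X=\sum_{m=0}^{\infty}\frac{1}{m!}\int_{\mathbb{X}^m}g(\{\mathbf{x}_1,\dots,\mathbf{x}_m\})\,\mathrm{d}\mathbf{x}_1\cdots\mathrm{d}\mathbf{x}_m ,$$ the $m=0$ term being $g(\emptyset)$. The conditional probability that exactly $n$ objects lie inside the field-of-view given $X$ is $$\rho_{\mathcal{S}}(n\mid X)=\sum_{X^n\subseteq X,\ |X^n|=n}\ \prod_{\mathbf{x}\in X^n}1_{\mathcal{S}}(\mathbf{x})\prod_{\mathbf{x}\in X\setminus X^n}(1-1_{\mathcal{S}}(\mathbf{x})),$$ and the field-of-view cardinality distribution is $\rho_{\mathcal{S}}(n)=\int\rho_{\mathcal{S}}(n\mid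 X)\,f(X)\,\delta X$. *)

(* Defs.v *)
From HB Require Import structures.
From mathcomp Require Import all_boot all_order all_algebra.
From mathcomp Require Import finmap.
From mathcomp Require Import all_classical all_reals all_analysis.

Set Implicit Arguments.
Unset Strict Implicit.
Unset Printing Implicit Defensive.

Import Order.TTheory GRing.Theory Num.Theory.
Import numFieldNormedType.Exports.

Local Open Scope classical_set_scope.
Local Open Scope ring_scope.

Section tuple_measure.
Context d (T : measurableType d) (R : realType).
Local Open Scope ereal_scope.

Definition tcons n (z : T * n.-tuple T) : n.+1.-tuple T := cons_tuple z.1 z.2.

(* The n-fold product measure on T^n; T^0 is one point, of mass 1. *)
Fixpoint tuple_measure (mu : set T -> \bar R) (n : nat) :
    set (n.-tuple T) -> \bar R :=
  match n with
  | 0 => \d_([tuple] : 0.-tuple T)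
  | n'.+1 => pushforward (mu \x @tuple_measure mu n') (@tcons n')
  end.

Variable mu : {sigma_finite_measure set T -> \bar R}.

Lemma measurable_tcons n : measurable_fun setT (@tcons n).
Proof. exact: measurable_cons. Qed.

Lemma sigma_finite_product d1 d2 (T1 : measurableType d1)
    (T2 : measurableType d2) (m1 : {sigma_finite_measure set T1 -> \bar R})
    (m2 : {sigma_finite_measure set T2 -> \bar R}) :
  sigma_finite setT (m1 \x m2).
Proof.
have /sigma_finiteP[F [TF ndF Foo]] := sigma_finiteT m1.
have /sigma_finiteP[G [TG ndG Goo]] := sigma_finiteT m2.
exists (fun n => F n `*` G n) => [|k]; last first.
  have [? ?] := Foo k; have [? ?] := Goo k.
  split; first exact: measurableX.
  by rewrite product_measure1E// lte_mul_pinfty// ge0_fin_numE.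
rewrite -setXTT TF TG predeqE => -[x y]; split.
  move=> [/= [n _ Fnx] [k _ Gky]]; exists (maxn n k) => //; split.
    by move: x Fnx; exact/subsetPset/ndF/leq_maxl.
  by move: y Gky; exact/subsetPset/ndG/leq_maxr.
by move=> [n _ []/= ? ?]; split; exists n.
Qed.

Lemma sigma_finite_pushforward_tcons n
    (m : set (T * n.-tuple T)%type -> \bar R) :
  sigma_finite setT m -> sigma_finite setT (pushforward m (@tcons n)).
Proof.
move=> [F FT mF].
pose g (t : n.+1.-tuple T) : T * n.-tuple T := (thead t, behead_tuple t).
have gK : cancel (@tcons n) g by case=> x t; congr pair; apply/val_inj.
have mg : measurable_fun setT g.
  apply/measurable_fun_pairP; split; first exact: (measurable_tnth ord0).
  rewrite (_ : _ \o _ = fun x : n.+1.-tuple T => [tuple of behead x]).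
    exact: measurable_behead.
  by apply/funext => t; apply/val_inj.
exists (fun i => g @^-1` F i).
  by rewrite -preimage_bigcup -FT preimage_setT.
move=> i; have [mFi Fioo] := mF i; split.
  by rewrite -[X in measurable X]setTI; exact: mg.
rewrite /pushforward -comp_preimage (_ : g \o @tcons n = id)//.
by apply/funext => z /=; exact: gK.
Qed.

Lemma tuple_measureP n :
  exists nu : {sigma_finite_measure set (n.-tuple T) -> \bar R},
    @tuple_measure mu n = nu.
Proof.
elim: n => [|n [nu nuE]].
  by exists (\d_([tuple] : 0.-tuple T)).
rewrite /= nuE.
pose m : {measure set (T * n.-tuple T)%type -> \bar R} := (mu \x nu).
pose pm : {measure set _ -> \bar R} :=
  measure_function_pushforward__canonical__measure_function_Measure
    m (@measurable_tcons n).
pose q := Measure_isSigmaFinite.Build _ _ _ pm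
  (sigma_finite_pushforward_tcons (sigma_finite_product mu nu)).
pose ps : {sigma_finite_measure set (n.+1.-tuple T) -> \bar R} :=
  HB.pack (pm : set _ -> \bar R) pm q.
by exists ps.
Qed.

Lemma tuple_measure0 n : @tuple_measure mu n set0 = 0.
Proof. by have [nu ->] := tuple_measureP n; rewrite measure0. Qed.

Lemma tuple_measure_ge0 n A : 0 <= @tuple_measure mu n A.
Proof. by have [nu ->] := tuple_measureP n. Qed.

Lemma tuple_measure_sigma_additive n :
  semi_sigma_additive (@tuple_measure mu n).
Proof.
by have [nu ->] := tuple_measureP n; exact: measure_semi_sigma_additive.
Qed.

HB.instance Definition _ n := isMeasure.Build _ _ _ (@tuple_measure mu n)
  (tuple_measure0 n) (@tuple_measure_ge0 n) (@tuple_measure_sigma_additive n).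

Lemma sigma_finite_tuple_measure n : sigma_finite setT (@tuple_measure mu n).
Proof. by have [nu ->] := tuple_measureP n; exact: sigma_finiteT. Qed.

HB.instance Definition _ n := Measure_isSigmaFinite.Build _ _ _
  (@tuple_measure mu n) (sigma_finite_tuple_measure n).

End tuple_measure.
Arguments tuple_measure {d T R} mu n.

Section finite_set_densities.
Context d (T : measurableType d) (R : realType).
Variables (mu : {measure set T -> \bar R}) (X : set T).

Definition set_integral (g : {fset T} -> \bar R) : \bar R :=
  (\sum_(0 <= m <oo) ((m`!%:R)^-1)%:E *
    \int[tuple_measure mu m]_(x in [set x | forall k, X (tnth x k)])
      g [fset y in tval x]%fset)%E.

Definition inner (f g : T -> R) : R := \int[mu]_(x in X) (f x * g x).

Definition is_pdf (p : T -> R) : Prop :=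
  [/\ measurable_fun X p, forall x, X x -> 0 <= p x &
      (\int[mu]_(x in X) (p x)%:E = 1)%E].

(* f is constrained at each finite subset of X through every enumeration of it
   without repetition; its values at other finite sets are irrelevant. *)
Definition is_multi_bernoulli_density (M : nat) (r : 'I_M -> R)
    (p : 'I_M -> T -> R) (f : {fset T} -> R) : Prop :=
  forall (n : nat) (x : n.-tuple T), uniq x -> (forall k, X (tnth x k)) ->
    f [fset y in tval x]%fset =
    \prod_(i < M) (1 - r i) *
    \sum_(t : n.-tuple 'I_M | uniq t)
      \prod_(k < n)
        (r (tnth t k) * p (tnth t k) (tnth x k) / (1 - r (tnth t k))).

End finite_set_densities.

Section field_of_view.
Context (R : realType) (ns nv : nat).

Definition euclidean (n : nat) := n.-tuple (measurableTypeR R).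

Definition lebesgue_euclidean (n : nat) : set (euclidean n) -> \bar R :=
  tuple_measure lebesgue_measure n.

HB.instance Definition _ n := SigmaFiniteMeasure.on (@lebesgue_euclidean n).

(* A state is a pair (s, v) in R^ns x R^nv. *)
Definition state := (euclidean ns * euclidean nv)%type.

Definition lebesgue_state : set state -> \bar R :=
  (@lebesgue_euclidean ns \x @lebesgue_euclidean nv)%E.

HB.instance Definition _ := Measure.on lebesgue_state.
HB.instance Definition _ := Measure_isSigmaFinite.Build _ _ _ lebesgue_state
  (sigma_finite_product (@lebesgue_euclidean ns) (@lebesgue_euclidean nv)).

(* Tuples carry no topology in the library, row vectors carry the usual one. *)
Definition compact_euclidean n (S : set (euclidean n)) : Prop :=
  compact [set (\row_(i < n) (tnth s i : R)) | s in S].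

Definition is_field_of_view (Xs S : set (euclidean ns)) : Prop :=
  S `<=` Xs /\ compact_euclidean S.

Definition gen_indic (S : set (euclidean ns)) (x : state) : R := \1_S x.1.

Definition cond_fov_card (S : set (euclidean ns)) (n : nat)
    (A : {fset state}) : R :=
  \sum_(B <- fpowerset A | #|` B|%fset == n)
    (\prod_(x <- B) gen_indic S x) *
    (\prod_(x <- (A `\` B)%fset) (1 - gen_indic S x)).

Definition fov_card (X : set state) (S : set (euclidean ns))
    (f : {fset state} -> R) (n : nat) : \bar R :=
  set_integral lebesgue_state X (fun A => (cond_fov_card S n A * f A)%:E).

End field_of_view.

(* Main.v *)
(* On tuples of distinct points, which have full measure since Lebesgue measure
   has no atoms, the conditional probability of n objects in S is the sum, over
   the sets J of n positions, of the indicator that exactly the points at J lie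
   in S. Multiplied by the multi-Bernoulli density, the integrand on X^m becomes
   a sum, over J and injective labellings t of the m points by components, of
   products of functions of a single point, so Tonelli turns each integral into
   a product of inner products. Each pair of disjoint index sets (I1, I2) with
   |I1| + |I2| = m and |I1| = n comes from exactly m! pairs (t, J), namely with
   I1 = t(J) and I2 = t(~J), which cancels the 1/m! of the set integral. The
   total mass is 1 because the sum over all disjoint pairs is the expansion of
   a product of the factors 1 + <1_S, q_i> + <1 - 1_S, q_i> = 1 / (1 - r_i),
   where q_i = r_i p_i / (1 - r_i). *)
Require Import Defs.
From mathcomp Require Import all_boot all_order all_algebra.
From mathcomp Require Import finmap.
From mathcomp Require Import all_classical all_reals all_analysis.
From mathcomp Require Import measurable_realfun.

Set Implicit Arguments.
Unset Strict Implicit.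
Unset Printing Implicit Defensive.

Import Order.TTheory GRing.Theory Num.Theory.
Import numFieldNormedType.Exports.

Local Open Scope ring_scope.

(** * Sums over labelled tuples *)

Lemma prod_choice (R : comPzRingType) (I : finType) (J : {set I})
    (F G : I -> R) :
  \prod_i (if i \in J then F i else G i) =
  \prod_(i in J) F i * \prod_(i in ~: J) G i.
Proof.
rewrite (bigID (mem J))/=; congr (_ * _).
  by apply: eq_bigr => i ->.
by apply: eq_big => [i|i /negbTE ->//]; rewrite ?inE.
Qed.

(** A factor is 1 where membership in [J] agrees with [P] and 0 where it does not, so one
    disagreement kills the product. *)
Lemma prod_choice_indic (R : comPzRingType) (I : finType) (P : pred I)
    (J : {set I}) :
  \prod_i (if i \in J then (P i)%:R else 1 - (P i)%:R) =
  (J == [set i | P i])%:R :> R.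
Proof.
have [->|JP] := eqVneq.
  rewrite big1// => i _; rewrite inE.
  by case: (P i) => //=; rewrite subr0.
have /existsP[i iJP] : [exists i, (i \in J) != P i].
  apply: contraNT JP => /existsPn JP; apply/eqP/setP => i.
  by rewrite inE; apply/eqP; rewrite -[_ == _]negbK; exact: JP.
rewrite (bigD1 i)//=; move: iJP; case: (i \in J); case: (P i) => //= _.
  by rewrite mul0r.
by rewrite subrr mul0r.
Qed.

(** Only [J = [set i | P i]] survives. Read from right to left, this turns a test on a cardinality
    into sums of products over positions, the shape that Tonelli can integrate. *)
Lemma sum_choice_indic (R : comPzRingType) (I : finType) (P : pred I) n :
  \sum_(J : {set I} | #|J| == n)
    \prod_i (if i \in J then (P i)%:R else 1 - (P i)%:R) =
  (#|[set i | P i]| == n)%:R :> R.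
Proof.
under eq_bigr do rewrite prod_choice_indic.
rewrite big_mkcond (bigD1 [set i | P i])//= eqxx big1 ?addr0; last first.
  by move=> J /negbTE ->; case: ifP.
by case: ifP.
Qed.

(** As [t] is injective, taking images under [tnth t] is a bijection from sets of positions to
    subsets of the entries of [t]; it keeps cardinalities and sends complements to complements. *)
Lemma sum_choice_tuple (R : comPzRingType) (I : finType) m (t : m.-tuple I) n
    (a b : I -> R) : uniq t ->
  \sum_(J : {set 'I_m} | #|J| == n)
    \prod_k (if k \in J then a (tnth t k) else b (tnth t k)) =
  \sum_(A : {set I} | (A \subset [set i in t]) && (#|A| == n))
    (\prod_(i in A) a i) * \prod_(i in [set i in t] :\: A) b i.
Proof.
move=> /tuple_uniqP t_inj.
have imT : tnth t @: [set: 'I_m] = [set i in t].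
  apply/setP => i; rewrite inE; apply/imsetP/tnthP => -[k].
    by move=> _ ->; exists k.
  by move=> ->; exists k.
rewrite [RHS](reindex_onto (fun J : {set 'I_m} => tnth t @: J)
  (fun A => tnth t @^-1: A))/=; last first.
  move=> A /andP[At _]; apply/setP => i; apply/imsetP/idP => [[k]|iA].
    by rewrite inE => ? ->.
  have /tnthP[k ik] : i \in t by have := fintype.subsetP At _ iA; rewrite inE.
  by exists k => //; rewrite inE -ik.
apply: eq_big => [J|J _].
  rewrite -imT finset.imsetS ?finset.subsetT//= card_imset//.
  rewrite (_ : _ @^-1: _ = J) ?eqxx ?andbT//.
  by apply/setP => k; rewrite inE mem_imset.
rewrite prod_choice; congr (_ * _).
  by rewrite big_imset//= => ? ? _ _; exact: t_inj.
rewrite -imT (_ : _ :\: _ = tnth t @: ~: J); last first.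
  apply/setP => i; rewrite inE.
  apply/andP/imsetP => [[iJ /imsetP[k _ ik]]|[k kJ ->]].
    by exists k => //; rewrite inE; apply: contra iJ => kJ; rewrite ik imset_f.
  by rewrite mem_imset// imset_f// inE in kJ *.
by rewrite big_imset//= => ? ? _ _; exact: t_inj.
Qed.

(** A repetition-free tuple of length [#|U|] with entries in [U] already exhausts [U], so these
    tuples are the injections counted by the falling factorial. *)
Lemma card_uniq_tuple_spanning (I : finType) (U : {set I}) :
  #|[set t : #|U|.-tuple I | uniq t & [set i in t] == U]| = (#|U|)`!.
Proof.
rewrite -ffactnn -card_uniq_tuples; apply: eq_card => t; rewrite !inE andbC.
have [ut|] := boolP (uniq t); last by rewrite !andbF.
rewrite !andbT eqEcard cardsE (card_uniqP ut) size_tuple leqnn andbT.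
by apply/fintype.subsetP/allP => tU i; have := tU i; rewrite inE.
Qed.

(** Tuples are grouped by their set of entries, each [m]-set having [m!] orderings. This is the
    factor that cancels the weight in the set integral. *)
Lemma sum_uniq_tuple_spanning (R : pzRingType) (I : finType) m
    (H : {set I} -> R) :
  \sum_(t : m.-tuple I | uniq t) H [set i in t] =
  m`!%:R * \sum_(U : {set I} | #|U| == m) H U.
Proof.
rewrite (partition_big (fun t : m.-tuple I => [set i in t])
  (fun U => #|U| == m))/=; last first.
  by move=> t ut; rewrite cardsE (card_uniqP ut) size_tuple.
rewrite mulr_sumr; apply: eq_bigr => U /eqP <-.
rewrite (eq_bigr (fun=> H U)) => [|t /andP[_ /eqP->]//].
rewrite sumr_const -[#|[pred _ | _]|]cardsE card_uniq_tuple_spanning.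
by rewrite mulr_natl.
Qed.

(** Reindexing along the bijection that sends a set [U] with a subset [A] to the disjoint pair
    [(A, U :\: A)], with inverse [(A, B)] to [(A :|: B, A)]. *)
Lemma sum_disjoint_pairs (R : pzRingType) (I : finType) (P : pred {set I})
    (Q : pred {set I}) (H : {set I} -> {set I} -> R) :
  \sum_(U : {set I} | P U) \sum_(A : {set I} | (A \subset U) && Q A)
    H A (U :\: A) =
  \sum_(I : {set I} * {set I} | [&& [disjoint I.1 & I.2], P (I.1 :|: I.2)
    & Q I.1]) H I.1 I.2.
Proof.
rewrite pair_big_dep/=.
rewrite (reindex_onto (fun p : {set I} * {set I} => (p.1 :|: p.2, p.1))
  (fun q => (q.2, q.1 :\: q.2)))/=; last first.
  move=> [U A]/= /and3P[_ AU _]; congr pair.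
  rewrite -[RHS](finset.setID U A); congr (_ :|: _).
  by apply/esym/finset.setIidPr.
have dE (p : {set I} * {set I}) :
    ((p.1 :|: p.2) :\: p.1 == p.2) = [disjoint p.1 & p.2].
  rewrite finset.setDUl finset.setDv finset.set0U disjoint_sym.
  by apply/eqP/idP => [/finset.setDidPl//|]; apply/finset.setDidPl.
apply: eq_big => [p|p /andP[_ /eqP pE]]; last by rewrite -[in RHS]pE.
rewrite finset.subsetUl/=.
case: p dE => A B /(_ (A, B))/=; rewrite xpair_eqE eqxx => -> /=.
by rewrite andbC.
Qed.

(** The constraint on [#|I.1 :|: I.2|] is kept as a factor, not as a condition on the index, so that
    a later sum over [m] can be exchanged with the sum over pairs. *)
Lemma sum_choice_uniq_tuple (R : comPzRingType) (I : finType) m n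
    (a b : I -> R) :
  \sum_(t : m.-tuple I | uniq t) \sum_(J : {set 'I_m} | #|J| == n)
    \prod_k (if k \in J then a (tnth t k) else b (tnth t k)) =
  m`!%:R * \sum_(I : {set I} * {set I} | [disjoint I.1 & I.2])
    (#|I.1 :|: I.2| == m)%:R * ((#|I.1| == n)%:R *
      (\prod_(i in I.1) a i) * (\prod_(i in I.2) b i)).
Proof.
under eq_bigr => t ut do rewrite sum_choice_tuple//.
rewrite (sum_uniq_tuple_spanning _ (fun U => \sum_(A : {set I} |
   (A \subset U) && (#|A| == n))
   (\prod_(i in A) a i) * \prod_(i in U :\: A) b i)).
rewrite (sum_disjoint_pairs (fun U => #|U| == m) (fun A => #|A| == n)
  (fun A B => (\prod_(i in A) a i) * \prod_(i in B) b i)).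
congr (_ * _); rewrite big_mkcondr/=; apply: eq_bigr => -[A B] _ /=.
by case: eqP => _; case: eqP => _; rewrite ?mul1r ?mul0r ?mulr0.
Qed.

(** Expanding the product, each index picks 1, [a i] or [b i]. The expansion first chooses the set
    [B] of indices that pick [b], then [A] inside its complement. *)
Lemma sum_disjoint_prod (R : comPzRingType) (I : finType) (a b : I -> R) :
  \sum_(I : {set I} * {set I} | [disjoint I.1 & I.2])
    (\prod_(i in I.1) a i) * (\prod_(i in I.2) b i) =
  \prod_i (1 + a i + b i).
Proof.
have distrA (B : {set I}) : \prod_(i in ~: B) (1 + a i) =
    \sum_(A : {set I} | [disjoint A & B]) \prod_(i in A) a i.
  (* On [B] the missing factor 1 is written as 0 + 1, so that in the expansion every [A] meeting [B]
     contributes 0. *)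
  rewrite big_mkcond (eq_bigr (fun i => (if i \in B then 0 else a i) + 1));
    last first.
    by move=> i _; rewrite inE addrC; case: (i \in B); rewrite /= ?add0r.
  rewrite bigA_distr [RHS]big_mkcond; apply: eq_bigr => A _.
  rewrite prod_choice [X in _ * X]big1// mulr1; case: ifP => [AB|/negbT].
    by apply: eq_bigr => i iA; rewrite (disjointFr AB iA).
  rewrite -finset.setI_eq0 => /finset.set0Pn[i]; rewrite inE => /andP[iA iB].
  by rewrite (bigD1 i)//= iB mul0r.
under [RHS]eq_bigr do rewrite addrC.
rewrite bigA_distr/=.
under [RHS]eq_bigr do rewrite prod_choice distrA mulr_sumr.
rewrite pair_big_dep/= (reindex (fun p : {set I} * {set I} => (p.2, p.1))).
  by apply: eq_bigr => p _; rewrite mulrC.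
by exists (fun p => (p.2, p.1)) => -[].
Qed.

Local Open Scope classical_set_scope.

(** * Product measures on tuples *)

Section null_set.
Context d (T : measurableType d) (R : realType).
Variables (mu : {measure set T -> \bar R}) (N : set T).
Hypotheses (mN : measurable N) (muN : mu N = 0%E).
Local Open Scope ereal_scope.
Import HBNNSimple.

(** The integral of a nonnegative function is a supremum over simple functions below it. A simple
    [h] below [f], cut to 0 on [N], lies below [g] and keeps its integral. *)
Lemma ge0_le_integral_off_null (f g : T -> \bar R) :
  (forall x, 0 <= f x) -> (forall x, 0 <= g x) ->
  (forall x, ~ N x -> f x = g x) ->
  \int[mu]_x f x <= \int[mu]_x g x.
Proof.
move=> f0 g0 fg; rewrite !ge0_integralTE//.
apply: ge_ereal_sup => _ [h /= hf <-].
apply: ereal_sup_ubound; exists (proj_nnsfun h (measurableC mN)) => /=.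
  move=> x; rewrite mindicE; have [/set_mem xN|] := boolP (x \in ~` N).
    by rewrite mulr1 -fg.
  by rewrite mulr0.
rewrite -[RHS]integralT_nnsfun (@ge0_negligible_integral _ _ _ _ _ N)//.
- rewrite setTD integral_nnsfun; last exact: measurableC.
  by rewrite (mrestrict _ (measurableC mN)).
- exact/measurable_EFinP.
- by move=> x _; rewrite lee_fin.
Qed.

(* Neither function is assumed measurable: on tuples with repetitions the
   integrand of a set integral is controlled only piecewise. *)
Lemma eq_integral_off_null (D : set T) (f g : T -> \bar R) :
  (forall x, D x -> ~ N x -> f x = g x) ->
  \int[mu]_(x in D) f x = \int[mu]_(x in D) g x.
Proof.
move=> fg; rewrite [LHS]integral_mkcond [RHS]integral_mkcond.
have {}fg x : ~ N x -> (f \_ D) x = (g \_ D) x.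
  by move=> Nx; rewrite /patch; case: ifPn => // /set_mem Dx; exact: fg.
rewrite [LHS]integralE [RHS]integralE.
congr (_ - _); apply/eqP; rewrite eq_le; apply/andP; split;
  apply: ge0_le_integral_off_null => // x /fg fgx;
  by rewrite ?funeposE ?funenegE fgx.
Qed.

End null_set.

(** A singleton is a section of the diagonal. *)
Lemma measurable_set1_diag d (T : measurableType d) (x : T) :
  measurable [set z : T * T | z.1 = z.2] -> measurable [set x].
Proof.
move=> mdiag.
have -> : [set x] = xsection [set z : T * T | z.1 = z.2] x.
  by apply/seteqP; split => y /=; rewrite /xsection/= inE/=.
exact: measurable_xsection.
Qed.

Section tuple_measure_theory.
Context d (T : measurableType d) (R : realType).
Variable mu : {sigma_finite_measure set T -> \bar R}.
Local Open Scope ereal_scope.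

Lemma tuple_measureS n :
  tuple_measure mu n.+1 =
  pushforward (mu \x tuple_measure mu n) (@tcons _ T n).
Proof. by []. Qed.

(** Induction on [n]: undoing the pushforward by [tcons], Tonelli integrates the tail to a constant
    by the induction hypothesis and leaves the integral over the head. *)
Lemma integral_tuple_measure_prod n (h : 'I_n -> T -> R) (c : 'I_n -> R) :
  (forall i, measurable_fun setT (h i)) -> (forall i x, (0 <= h i x)%R) ->
  (forall i, \int[mu]_x (h i x)%:E = (c i)%:E) ->
  \int[tuple_measure mu n]_x (\prod_i h i (tnth x i))%:E = (\prod_i c i)%:E.
Proof.
elim: n h c => [|n IH] h c mh h0 hc.
  have -> : (fun x : 0.-tuple T => (\prod_i h i (tnth x i))%:E) = cst 1.
    by apply/funext => x; rewrite big_ord0.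
  rewrite big_ord0 integral_cst//=.
  by rewrite diracT mule1.
have mprod k (g : 'I_k -> T -> R) : (forall i, measurable_fun setT (g i)) ->
    measurable_fun [set: k.-tuple T] (fun x => (\prod_i g i (tnth x i))%:E).
  move=> mg; apply/measurable_EFinP/measurable_prod => i _.
  by apply: measurableT_comp => //; exact: measurable_tnth.
rewrite /= ge0_integral_pushforward//; last 3 first.
- exact: measurable_tcons.
- exact: mprod.
- by move=> x _; rewrite lee_fin prodr_ge0.
rewrite preimage_setT fubini_tonelli1//; last 2 first.
- apply: measurableT_comp; first exact: mprod.
  exact: measurable_tcons.
- by move=> x; rewrite lee_fin prodr_ge0.
have int_cons x : \int[tuple_measure mu n]_t
    (\prod_(i < n.+1) h i (tnth (tcons (x, t)) i))%:E =
    (\prod_(i < n) c (lift ord0 i))%:E * (h ord0 x)%:E.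
  rewrite muleC -(IH (fun i => h (lift ord0 i)))//.
  rewrite -ge0_integralZl_EFin//; last 2 first.
  - by move=> t _; rewrite lee_fin prodr_ge0.
  - exact: (mprod n (fun i => h (lift ord0 i))).
  apply: eq_integral => t _; rewrite big_ord_recl EFinM.
  congr (_ * (_)%:E); apply: eq_bigr => i _; congr (h _ _).
  by rewrite tnthS; congr tnth; exact: val_inj.
rewrite /fubini_F/=; under eq_integral do rewrite int_cons.
rewrite ge0_integralZl_EFin//.
- by rewrite hc big_ord_recl mulrC.
- by move=> x _; rewrite lee_fin.
- exact/measurable_EFinP.
- apply: prodr_ge0 => i _; rewrite -lee_fin -hc.
  by apply: integral_ge0 => x _; rewrite lee_fin.
Qed.

Hypothesis mdiag : measurable [set z : T * T | z.1 = z.2].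
Hypothesis mu1 : forall x, mu [set x] = 0.

Lemma null_set_mem_seq (s : seq T) :
  measurable [set x | x \in s] /\ mu [set x | x \in s] = 0.
Proof.
elim: s => [|a s [ms mus]].
  have -> : [set x : T | x \in [::]] = set0 by apply/seteqP; split.
  by rewrite measure0.
have -> : [set x | x \in a :: s] = [set a] `|` [set x | x \in s].
  apply/seteqP; split => x /=; rewrite in_cons.
    by case/predU1P; [left|right].
  by case=> [->|->]; rewrite ?eqxx ?orbT.
have ma := measurable_set1_diag a mdiag.
by split; [exact: measurableU|rewrite measureU0//; exact: mu1].
Qed.

Lemma measurable_eq_tnth n (i j : 'I_n) :
  measurable [set x : n.-tuple T | tnth x i = tnth x j].
Proof.
have mij : measurable_fun setT (fun x : n.-tuple T => (tnth x i, tnth x j)).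
  by apply: measurable_fun_pair; exact: measurable_tnth.
by have := mij measurableT _ mdiag; rewrite setTI.
Qed.

Lemma measurable_not_uniq n : measurable [set x : n.-tuple T | ~~ uniq x].
Proof.
have -> : [set x : n.-tuple T | ~~ uniq x] =
    \bigcup_(p in [set p : 'I_n * 'I_n | p.1 != p.2])
      [set x | tnth x p.1 = tnth x p.2].
  apply/seteqP; split => [x /= /tuple_uniqP ux|x [[i j] /= ij xij]].
    apply: contra_notP ux => nx i j xij; apply: contrapT => /eqP ij.
    by apply: nx; exists (i, j).
  apply/negP => /tuple_uniqP xinj.
  by rewrite (xinj _ _ xij) eqxx in ij.
by apply: fin_bigcup_measurable => // -[i j] _; exact: measurable_eq_tnth.
Qed.

(** A tuple has a repetition when its head occurs in its tail or its tail has one. The second event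
    is null by induction, the first because for a fixed tail only finitely many heads are
    possible. *)
Lemma tuple_measure_not_uniq n :
  tuple_measure mu n [set x : n.-tuple T | ~~ uniq x] = 0.
Proof.
elim: n => [|n IH].
  rewrite (_ : [set x | _] = set0) ?measure0//.
  by apply/seteqP; split => // x /=; rewrite tuple0.
rewrite tuple_measureS /pushforward.
pose A := [set z : T * n.-tuple T | z.1 \in tval z.2].
have mA : measurable A.
  have -> : A = \bigcup_(i in [set: 'I_n]) [set z | z.1 = tnth z.2 i].
    apply/seteqP; split => [z /tnthP[i zi]|z [i _ /= zi]]; first by exists i.
    by apply/tnthP; exists i.
  apply: fin_bigcup_measurable => // i _.
  have mi : measurable_fun setT (fun z : T * n.-tuple T => (z.1, tnth z.2 i)).
    apply: measurable_fun_pair => //.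
    exact: (measurableT_comp (measurable_tnth i) measurable_snd).
  by have := mi measurableT _ mdiag; rewrite setTI.
have mN := @measurable_not_uniq n.
have -> : @tcons _ T n @^-1` [set x | ~~ uniq x] =
    A `|` (setT `*` [set x : n.-tuple T | ~~ uniq x]).
  apply/seteqP; split => [[x t] /=|[x t] /=]; rewrite negb_and negbK.
    by case/orP => ?; [left|right].
  by case=> [->|[_ ->]]; rewrite ?orbT.
have N0 : (mu \x tuple_measure mu n)
    (setT `*` [set x : n.-tuple T | ~~ uniq x]) = 0.
  by rewrite product_measure1E// [X in _ * X]IH mule0.
rewrite measureU0//; last exact: measurableX.
(* The product measure is computed in the other order, so that its sections fix the tail and let the
   head vary. *)
transitivity ((mu \x^ tuple_measure mu n) A).
  by apply: product_measure_unique => //= *; rewrite product_measure2E.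
rewrite /product_measure2 integral0_eq// => t _ /=.
rewrite (_ : ysection A t = [set x | x \in tval t]).
  by have [] := null_set_mem_seq t.
by apply/seteqP; split => x /=; rewrite /ysection/= inE/=.
Qed.

End tuple_measure_theory.

(** * The state space *)

Lemma measurable_tuple_diag d (T : measurableType d) n :
  measurable [set z : T * T | z.1 = z.2] ->
  measurable [set z : n.-tuple T * n.-tuple T | z.1 = z.2].
Proof.
move=> mdiag.
have -> : [set z : n.-tuple T * n.-tuple T | z.1 = z.2] =
    \bigcap_(i in [set: 'I_n]) [set z | tnth z.1 i = tnth z.2 i].
  apply/seteqP; split => [[x y] /= -> //|[x y] xy].
  by apply: eq_from_tnth => i; exact: xy.
apply: fin_bigcap_measurable => // i _.
have mi : measurable_fun setT
    (fun z : n.-tuple T * n.-tuple T => (tnth z.1 i, tnth z.2 i)).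
  apply: measurable_fun_pair.
    exact: (measurableT_comp (measurable_tnth i) measurable_fst).
  exact: (measurableT_comp (measurable_tnth i) measurable_snd).
by have := mi measurableT _ mdiag; rewrite setTI.
Qed.

Lemma measurable_pair_diag d1 d2 (T1 : measurableType d1)
    (T2 : measurableType d2) :
  measurable [set z : T1 * T1 | z.1 = z.2] ->
  measurable [set z : T2 * T2 | z.1 = z.2] ->
  measurable [set z : (T1 * T2) * (T1 * T2) | z.1 = z.2].
Proof.
move=> m1 m2.
have -> : [set z : (T1 * T2) * (T1 * T2) | z.1 = z.2] =
    [set z | z.1.1 = z.2.1] `&` [set z | z.1.2 = z.2.2].
  apply/seteqP; split => [[[x1 x2] [y1 y2]] /= [-> ->]//|].
  by move=> [[x1 x2] [y1 y2]] /= [-> ->].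
apply: measurableI.
  have m11 : measurable_fun setT
      (fun z : (T1 * T2) * (T1 * T2) => (z.1.1, z.2.1)).
    by apply: measurable_fun_pair; exact: measurableT_comp.
  by have := m11 measurableT _ m1; rewrite setTI.
have m22 : measurable_fun setT
    (fun z : (T1 * T2) * (T1 * T2) => (z.1.2, z.2.2)).
  by apply: measurable_fun_pair; exact: measurableT_comp.
by have := m22 measurableT _ m2; rewrite setTI.
Qed.

Lemma measurable_real_diag (R : realType) :
  measurable [set z : measurableTypeR R * measurableTypeR R | z.1 = z.2].
Proof.
have mfst := @measurable_fst _ _ (measurableTypeR R) (measurableTypeR R).
have msnd := @measurable_snd _ _ (measurableTypeR R) (measurableTypeR R).
have := measurable_fun_eqr mfst msnd => /(_ measurableT [set true] I).
rewrite setTI; congr measurable; apply/seteqP.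
by split => z /eqP.
Qed.

(** Compactness lives on row vectors, measurability on the product sigma-algebra of tuples. Balls of
    row vectors are products of intervals, hence measurable as tuples, and a compact set is a
    countable intersection of finite unions of such balls. *)
Lemma compact_euclidean_measurable (R : realType) n (S : set (euclidean R n)) :
  compact_euclidean S -> measurable S.
Proof.
pose phi (x : euclidean R n) : 'rV[R]_n := \row_(i < n) (tnth x i : R).
move=> cS; set K := [set phi x | x in S].
have {}cS : compact K by exact: cS.
have clK : closed K by exact: compact_closed.
have ball_ge0 k : 0 < k.+1%:R^-1 :> R by rewrite invr_gt0.
have /choice[D DP] : forall k : nat, exists D : {fset 'rV[R]_n},
    {subset D <= K} /\ K `<=` \bigcup_(y in [set` D]) ball y k.+1%:R^-1.
  move=> k; move: cS; rewrite compact_cover => cS.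
  have [||D DK KD] := cS _ K (fun y => (ball y k.+1%:R^-1)^°).
  - by move=> y _; exact: open_interior.
  - by move=> y Ky; exists y => //; exact: nbhsx_ballx.
  exists D; split=> // x /KD[y Dy xy]; exists y => //.
  exact: interior_subset.
(* finite covers of K by balls of radius 1 / (k + 1), which are boxes *)
have SE : S = \bigcap_k
    \bigcup_(y in [set` D k]) [set x | ball y k.+1%:R^-1 (phi x)].
  apply/seteqP; split => [x Sx k _|x Ux].
    by have [_ KD] := DP k; apply: KD; exists x.
  suff [y Sy /rowP yx] : K (phi x).
    rewrite (_ : x = y)//; apply: eq_from_tnth => i.
    by have := yx i; rewrite !mxE.
  (* A point off the closed set [K] has a ball of some radius [e] missing [K], yet the cover with
     radius below [e] puts a centre, which lies in [K], inside that ball. *)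
  apply: contrapT => nKx.
  have : nbhs (phi x) (~` K)
    by apply: open_nbhs_nbhs; split => //; exact: closed_openC.
  rewrite -nbhs_ballE => -[e /= e0 eK].
  have [k ke] : exists k, k.+1%:R^-1 < e.
    have [k _ ek] := near_infty_natSinv_lt (PosNum e0).
    by exists k; apply: ek => /=.
  have [y /= Dy xy] := Ux k I.
  have /set_mem Ky := (DP k).1 _ Dy.
  apply: (eK y) => //; apply: (le_ball (ltW ke)); exact: ball_sym.
rewrite SE; apply: bigcapT_measurable => k.
apply: fin_bigcup_measurable => // y _.
have -> : [set x | ball y k.+1%:R^-1 (phi x)] =
    \bigcap_(i in [set: 'I_n])
      (fun x : euclidean R n => tnth x i) @^-1` (ball (y 0 i) k.+1%:R^-1).
  apply/seteqP; split => [x [_ yx] i _|x yx].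
    by have := yx 0 i; rewrite mxE.
  split => // i j; rewrite mxE ord1; exact: yx.
apply: fin_bigcap_measurable => // i _.
rewrite -[X in measurable X]setTI; apply: measurable_tnth => //.
exact: measurable_ball.
Qed.

Section state_space.
Context (R : realType) (ns nv : nat).

Lemma measurable_state_diag :
  measurable [set z : state R ns nv * state R ns nv | z.1 = z.2].
Proof.
by apply: measurable_pair_diag; apply: measurable_tuple_diag;
  exact: measurable_real_diag.
Qed.

Lemma lebesgue_euclideanS_set1 n (x : euclidean R n.+1) :
  lebesgue_euclidean [set x] = 0%E.
Proof.
case/tupleP: x => a t.
rewrite /lebesgue_euclidean /= /pushforward.
have -> : @tcons _ (measurableTypeR R) n @^-1` [set [tuple of a :: t]] =
    [set a] `*` [set t].
  apply/seteqP; split => [[b u] /= /(congr1 val)[-> ut]|[b u] /= [-> ->]].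
    by split => //; exact: val_inj.
  exact: val_inj.
have mt := measurable_set1_diag t
  (measurable_tuple_diag (@measurable_real_diag R)).
have ma := measurable_set1_diag a (@measurable_real_diag R).
by rewrite product_measure1E// [X in (X * _)%E]lebesgue_measure_set1 mul0e.
Qed.

(** One of the two factors has positive dimension, so its singletons are null. In total dimension 0
    the state space would be one point of mass 1. *)
Lemma lebesgue_state_set1 (x : state R ns nv) : (0 < ns + nv)%N ->
  lebesgue_state [set x] = 0%E.
Proof.
case: x => s v; rewrite addn_gt0.
have -> : [set (s, v)] = [set s] `*` [set v].
  by apply/seteqP; split => [[? ?] [-> ->]//|[? ?] [/= -> ->]].
have ms n (t : euclidean R n) : measurable [set t].
  exact: measurable_set1_diag (measurable_tuple_diag (@measurable_real_diag R)).
rewrite /lebesgue_state product_measure1E; [|exact: ms|exact: ms].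
case/orP.
  case: ns s => // n s _.
  by rewrite [X in (X * _)%E]lebesgue_euclideanS_set1 mul0e.
case: nv v => // n v _.
by rewrite [X in (_ * X)%E]lebesgue_euclideanS_set1 mule0.
Qed.

End state_space.

(** * Field-of-view cardinality *)

Lemma gen_indicE (R : realType) (ns nv : nat) (S : set (euclidean R ns))
    (x : state R ns nv) : gen_indic S x = (x.1 \in S)%:R.
Proof. by rewrite /gen_indic indicE. Qed.

Lemma cond_fov_cardE (R : realType) (ns nv : nat) (S : set (euclidean R ns))
    (n : nat) (A : {fset state R ns nv}) :
  cond_fov_card S n A = (#|` [fset x in A | x.1 \in S]%fset| == n)%:R.
Proof.
(* only the term B = A inter S is nonzero *)
set K := [fset x in A | _]%fset.
have termE (B : {fset state R ns nv}) : (B `<=` A)%fset ->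
    (\prod_(x <- B) gen_indic S x) *
    (\prod_(x <- (A `\` B)%fset) (1 - gen_indic S x)) = (B == K)%:R.
  move=> BA; have [->|BK] := eqVneq B K.
    rewrite !big_seq !big1 ?mulr1// => x; rewrite !inE gen_indicE.
      by move=> /andP[/negbTE + xA]; rewrite xA/= => ->; rewrite subr0.
    by move=> /andP[_ ->].
  (* A point of [B] outside [S] annuls the first product; otherwise [B] is a proper subset of [K],
     and a point of [K] missing from [B] annuls the second. *)
  have [BS|] := boolP (all (fun x => x.1 \in S) B); last first.
    move=> /allPn[x xB xS]; rewrite (bigD1_seq x xB (fset_uniq B))/= gen_indicE.
    by rewrite (negbTE xS) !mul0r.
  have BsubK : (B `<=` K)%fset.
    apply/fsubsetP => x xB; rewrite !inE (fsubsetP BA _ xB)/=.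
    exact: (allP BS).
  have /fsubsetPn[x xK xB] : ~~ (K `<=` B)%fset.
    by apply: contra BK => KB; rewrite eqEfsubset BsubK.
  move: xK; rewrite !inE => /andP[xA xS].
  have xAB : x \in (A `\` B)%fset by rewrite !inE xB.
  rewrite [X in _ * X](bigD1_seq x xAB (fset_uniq _))/=.
  by rewrite gen_indicE xS subrr mul0r mulr0.
have KA : (K `<=` A)%fset.
  by apply/fsubsetP => x; rewrite !inE => /andP[].
have KpA : K \in fpowerset A by rewrite fpowersetE.
rewrite /cond_fov_card big_mkcond (bigD1_seq K KpA (fset_uniq _))/=.
rewrite [X in _ + X]big_seq_cond [X in _ + X]big1 ?addr0.
  by rewrite termE// eqxx; case: ifP.
move=> B /andP[]; rewrite fpowersetE => BA BK.
by rewrite termE// (negbTE BK); case: ifP.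
Qed.

(** Without repetitions, points correspond to positions, so counting the points in [S] amounts to
    counting positions. *)
Lemma cond_fov_card_uniq (R : realType) (ns nv : nat) (S : set (euclidean R ns))
    (n m : nat) (x : m.-tuple (state R ns nv)) : uniq x ->
  cond_fov_card S n [fset y in tval x]%fset =
  \sum_(J : {set 'I_m} | #|J| == n)
    \prod_k (if k \in J then gen_indic S (tnth x k)
             else 1 - gen_indic S (tnth x k)).
Proof.
move=> ux; rewrite cond_fov_cardE sum_choice_indic; congr (_ == _)%:R.
rewrite (_ : [fset y in _ | _]%fset =
    [fset y in [seq z <- tval x | z.1 \in S]]%fset); last first.
  by apply/fsetP => y; rewrite !inE/= mem_filter andbC.
rewrite card_fseq undup_id ?filter_uniq// size_filter cardsE -sum1_card.
by rewrite -sum1_count big_tuple.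
Qed.

(** Each [h i] equals exactly one [m] below [N]. It removes the sum over the total number of
    objects, where [h] is [#|I.1 :|: I.2|], and later the sum over [n], where [h] is [#|I.1|]. *)
Lemma sum_nat_indic (R : pzSemiRingType) (I : finType) (P : pred I)
    (h : I -> nat) (G : I -> R) N : (forall i, P i -> (h i < N)%N) ->
  \sum_(m < N) \sum_(i | P i) (h i == m)%:R * G i = \sum_(i | P i) G i.
Proof.
move=> hN; rewrite exchange_big/=; apply: eq_bigr => i /hN hi.
rewrite (bigD1 (Ordinal hi))//= eqxx mul1r big1 ?addr0// => j.
by rewrite -val_eqE/= eq_sym => /negbTE ->; rewrite mul0r.
Qed.

Lemma eseries_finite (R : realType) (u : nat -> R) N :
  (forall k, (N <= k)%N -> u k = 0) ->
  (\sum_(0 <= k <oo) (u k)%:E = (\sum_(k < N) u k)%:E)%E.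
Proof.
move=> u0; apply: lim_near_cst => //; near=> k.
have Nk : (N <= k)%N by near: k; exact: nbhs_infty_ge.
rewrite sumEFin (big_cat_nat (leq0n N) Nk)/=.
rewrite [X in _ + X]big_nat_cond [X in _ + X]big1 ?addr0.
  by rewrite big_mkord.
by move=> i /andP[/andP[/u0]].
Unshelve. all: by end_near. Qed.

Lemma integral_sum_EFin d (T : measurableType d) (R : realType)
    (mu : {measure set T -> \bar R}) (I : finType) (P : pred I)
    (g : I -> T -> R) (c : I -> R) :
  (forall i, measurable_fun setT (g i)) -> (forall i x, 0 <= g i x) ->
  (forall i, P i -> \int[mu]_x (g i x)%:E = (c i)%:E)%E ->
  (\int[mu]_x (\sum_(i | P i) g i x)%:E = (\sum_(i | P i) c i)%:E)%E.
Proof.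
move=> mg g0 gc; under eq_integral do rewrite -sumEFin -big_filter.
rewrite ge0_integral_sum//.
- rewrite big_filter -sumEFin; exact: eq_bigr.
- by move=> i; exact/measurable_EFinP.
- by move=> i x _; rewrite lee_fin.
Qed.

(** * Integrals of one weighted single-object density *)

Section weighted_density.
Context d (T : measurableType d) (R : realType).
Variables (mu : {measure set T -> \bar R}) (X : set T) (mX : measurable X).
Variables (p : T -> R) (pdf : is_pdf mu X p) (r : R) (r0 : 0 <= r).

Lemma measurable_weighted_density (w : T -> R) : measurable_fun setT w ->
  measurable_fun X (fun x => w x * (r * p x)).
Proof.
move=> mw; have [mp _ _] := pdf.
apply: measurable_funM; first exact: measurable_funTS.
exact: measurable_funM.
Qed.

(** [inner] is the [fine] part of an extended integral and would be 0 if that integral were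
    infinite. The bound [w x <= 1] keeps it at most [r], so nothing is lost. *)
Lemma integral_weighted_density (w : T -> R) : measurable_fun setT w ->
  (forall x, 0 <= w x <= 1) ->
  (\int[mu]_(x in X) (w x * (r * p x))%:E =
   (inner mu X w (fun x => r * p x)%R)%:E)%E.
Proof.
move=> mw w01; have [mp p0 p1] := pdf.
rewrite /inner /Rintegral fineK// ge0_fin_numE; last first.
  apply: integral_ge0 => x Xx; have /andP[? _] := w01 x.
  by rewrite lee_fin !mulr_ge0// p0.
apply: (@le_lt_trans _ _ (\int[mu]_(x in X) (r%:E * (p x)%:E)))%E.
  apply: ge0_le_integral => //.
  - move=> x Xx; have /andP[? _] := w01 x.
    by rewrite lee_fin !mulr_ge0// p0.
  - exact/measurable_EFinP/measurable_weighted_density.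
  - by apply/measurable_EFinP; exact: measurable_funM.
  - move=> x Xx; have /andP[_ ?] := w01 x.
    by rewrite -EFinM lee_fin ler_piMl// mulr_ge0// p0.
rewrite ge0_integralZl_EFin//.
- by rewrite p1 mule1 ltry.
- exact/measurable_EFinP.
Qed.

Lemma inner_complement (w : T -> R) : measurable_fun setT w ->
  (forall x, 0 <= w x <= 1) ->
  inner mu X w (fun x => r * p x) +
  inner mu X (fun x => 1 - w x) (fun x => r * p x) = r.
Proof.
move=> mw w01; have [mp p0 p1] := pdf.
have mw' : measurable_fun setT (fun x => 1 - w x) by exact: measurable_funB.
have w01' x : 0 <= 1 - w x <= 1.
  by have /andP[? ?] := w01 x; rewrite subr_ge0 gerBl; apply/andP.
apply: EFin_inj; rewrite EFinD -!integral_weighted_density//.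
rewrite -ge0_integralD//; last 4 first.
- move=> x Xx; have /andP[? _] := w01 x.
  by rewrite lee_fin !mulr_ge0// p0.
- exact/measurable_EFinP/measurable_weighted_density.
- move=> x Xx; have /andP[? _] := w01' x.
  by rewrite lee_fin !mulr_ge0// p0.
- exact/measurable_EFinP/measurable_weighted_density.
transitivity (\int[mu]_(x in X) (r%:E * (p x)%:E))%E.
  apply: eq_integral => x _; rewrite -!EFinD -EFinM.
  by rewrite -mulrDl addrC subrK mul1r.
by rewrite ge0_integralZl_EFin// ?p1 ?mule1//; exact/measurable_EFinP.
Qed.

Lemma inner_ge0 (w : T -> R) : (forall x, 0 <= w x) ->
  0 <= inner mu X w (fun x => r * p x).
Proof.
have [mp p0 p1] := pdf.
by move=> w0; apply: Rintegral_ge0 => x Xx; rewrite !mulr_ge0// p0.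
Qed.

End weighted_density.

(** * The multi-Bernoulli integral for a fixed number of objects *)

Section multi_bernoulli_integral.
Context d (T : measurableType d) (R : realType).
Variables (mu : {sigma_finite_measure set T -> \bar R}) (X : set T).
Hypothesis mX : measurable X.
Variables (M : nat) (r : 'I_M -> R) (p : 'I_M -> T -> R).
Hypotheses (r01 : forall i, 0 <= r i < 1) (pdf : forall i, is_pdf mu X (p i)).
Variable w : T -> R.
Hypotheses (mw : measurable_fun setT w) (w01 : forall x, 0 <= w x <= 1).

Let coef (v : T -> R) i := inner mu X v (fun x => r i * p i x) / (1 - r i).

(** Extension by 0 outside [X] turns the integral over [X^m] into one over all tuples, where the
    product formula applies. *)
Let g (v : T -> R) i : T -> R :=
  (fun x => v x * (r i * p i x) / (1 - r i)) \_ X.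

Let onem_r_gt0 i : 0 < 1 - r i.
Proof. by rewrite subr_gt0; have /andP[] := r01 i. Qed.

Let r_ge0 i : 0 <= r i.
Proof. by have /andP[] := r01 i. Qed.

Let measurable_g (v : T -> R) i :
  measurable_fun setT v -> measurable_fun setT (g v i).
Proof.
move=> mv; apply/(measurable_restrictT _ mX).
by apply: measurable_funM => //; exact: measurable_weighted_density.
Qed.

Let g_ge0 (v : T -> R) i x : (forall x, 0 <= v x <= 1) -> 0 <= g v i x.
Proof.
move=> v01; apply: restrict_ge0 => y Xy.
have [_ p0 _] := pdf i; have /andP[v0 _] := v01 y.
by rewrite divr_ge0 ?mulr_ge0 ?p0// ltW.
Qed.

Let integral_g (v : T -> R) i :
  measurable_fun setT v -> (forall x, 0 <= v x <= 1) ->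
  (\int[mu]_x (g v i x)%:E = (coef v i)%:E)%E.
Proof.
move=> mv v01; have [_ p0 _] := pdf i.
rewrite /coef mulrC EFinM -(integral_weighted_density _ (pdf i))//.
rewrite -ge0_integralZl_EFin//.
- rewrite [RHS]integral_mkcond; apply: eq_integral => x _.
  by rewrite /g /patch; case: ifP => // _; rewrite mulrC.
- by move=> x Xx; have /andP[? _] := v01 x; rewrite lee_fin !mulr_ge0 ?p0.
- exact/measurable_EFinP/measurable_weighted_density.
- by rewrite invr_ge0 ltW.
Qed.

Let wc x := 1 - w x.

Let mwc : measurable_fun setT wc.
Proof. exact: measurable_funB. Qed.

Let wc01 x : 0 <= wc x <= 1.
Proof.
by have /andP[? ?] := w01 x; rewrite /wc subr_ge0 gerBl; apply/andP.
Qed.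

Lemma integral_multi_bernoulli_choice (m n : nat) :
  (\int[tuple_measure mu m]_(x in [set x | forall k, X (tnth x k)])
    ((\sum_(J : {set 'I_m} | #|J| == n)
        \prod_k (if k \in J then w (tnth x k) else 1 - w (tnth x k))) *
     (\prod_(i < M) (1 - r i) *
      \sum_(t : m.-tuple 'I_M | uniq t)
      \prod_(k < m)
        (r (tnth t k) * p (tnth t k) (tnth x k) / (1 - r (tnth t k)))))%:E =
   (\prod_(i < M) (1 - r i) *
    (m`!%:R * \sum_(I : {set 'I_M} * {set 'I_M} | [disjoint I.1 & I.2])
      (#|I.1 :|: I.2| == m)%:R * ((#|I.1| == n)%:R *
      (\prod_(i in I.1) coef w i) *
      (\prod_(i in I.2) coef (fun x => 1 - w x) i))))%:E)%E.
Proof.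
(* A pair [P] consists of a labelling of positions by components and the set of positions meant to
   lie in the field-of-view. *)
pose h (P : m.-tuple 'I_M * {set 'I_m}) k :=
  if k \in P.2 then g w (tnth P.1 k) else g wc (tnth P.1 k).
pose G P (x : m.-tuple T) := \prod_k h P k (tnth x k).
pose c (P : m.-tuple 'I_M * {set 'I_m}) := \prod_k
  (if k \in P.2 then coef w (tnth P.1 k) else coef wc (tnth P.1 k)).
have mh P k : measurable_fun setT (h P k).
  by rewrite /h; case: ifP => _; exact: measurable_g.
have h0 P k x : 0 <= h P k x by rewrite /h; case: ifP => _; exact: g_ge0.
have mG P : measurable_fun setT (G P).
  apply: measurable_prod => k _.
  exact: (measurableT_comp (mh P k) (measurable_tnth k)).
have G0 P x : 0 <= G P x by exact: prodr_ge0.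
rewrite integral_mkcond.
transitivity (\int[tuple_measure mu m]_x
  ((\prod_(i < M) (1 - r i))%:E *
   (\sum_(P : m.-tuple 'I_M * {set 'I_m} |
      uniq P.1 && (#|P.2| == n)) G P x)%:E))%E.
  apply: eq_integral => x _; rewrite /patch; case: ifPn => [|/negP Xx].
    rewrite inE/= => Xx; rewrite -EFinM mulrCA; congr (_ * _)%:E.
    rewrite mulr_suml; under [LHS]eq_bigr => J _ do rewrite mulr_sumr.
    rewrite exchange_big/= pair_big/=; apply: eq_bigr => -[t J] _ /=.
    rewrite -big_split/=; apply: eq_bigr => k _.
    by rewrite /h/=; case: ifP => _; rewrite /g /patch mem_set// !mulrA.
  (* Outside [X^m] some coordinate leaves [X], and its factor annuls every product, in agreement
     with the restricted integrand. *)
  suff [k nXk] : exists k, ~ X (tnth x k).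
    rewrite [X in (_ * X%:E)%E]big1 ?mule0// => P _; rewrite /G (bigD1 k)//=.
    by rewrite /h; case: ifP => _; rewrite /g /patch memNset// mul0r.
  by apply/existsNP => Xx'; apply: Xx; rewrite inE.
rewrite ge0_integralZl_EFin//; last 3 first.
- by move=> x _; rewrite lee_fin sumr_ge0.
- apply/measurable_EFinP.
  under eq_fun do rewrite -big_filter.
  exact: measurable_sum.
- by apply: prodr_ge0 => i _; exact: ltW.
rewrite (@integral_sum_EFin _ _ _ _ _ _ G c)//; last first.
  move=> P _; apply: integral_tuple_measure_prod => // k.
  by rewrite /h; case: ifP => _; exact: integral_g.
rewrite -EFinM; congr (_ * _)%:E.
rewrite -(sum_choice_uniq_tuple m n (coef w) (coef wc)) pair_big/=.
by apply: eq_bigr => -[].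
Qed.

End multi_bernoulli_integral.

Theorem proposition3 (R : realType) (ns nv : nat) (dim_gt0 : (0 < ns + nv)%N)
  (Xs : set (euclidean R ns)) (Xv : set (euclidean R nv))
  (mXs : measurable Xs) (mXv : measurable Xv)
  (M : nat) (r : 'I_M -> R) (p : 'I_M -> state R ns nv -> R)
  (r01 : forall i, 0 <= r i < 1)
  (pdf : forall i, is_pdf (@lebesgue_state R ns nv) (Xs `*` Xv) (p i))
  (f : {fset state R ns nv} -> R)
  (fE : is_multi_bernoulli_density (Xs `*` Xv) r p f)
  (S : set (euclidean R ns)) (fovS : is_field_of_view Xs S) :
  (forall n : nat,
    fov_card (Xs `*` Xv) S f n =
    (\prod_(i < M) (1 - r i) *
     \sum_(I : {set 'I_M} * {set 'I_M} | [disjoint I.1 & I.2])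
       (#|I.1| == n)%:R *
       (\prod_(i in I.1)
          (inner (@lebesgue_state R ns nv) (Xs `*` Xv)
             (gen_indic S) (fun x => r i * p i x) / (1 - r i))) *
       (\prod_(i in I.2)
          (inner (@lebesgue_state R ns nv) (Xs `*` Xv)
             (fun x => 1 - gen_indic S x) (fun x => r i * p i x)
           / (1 - r i))))%:E)
  /\ (forall n : nat, 0 <= fov_card (Xs `*` Xv) S f n)%E
  /\ (\sum_(0 <= n <oo) fov_card (Xs `*` Xv) S f n = 1)%E.
Proof.
set X := Xs `*` Xv; set mu := @lebesgue_state R ns nv.
have mX : measurable X by exact: measurableX.
have mw : measurable_fun setT (gen_indic S : state R ns nv -> R).
  have mS := compact_euclidean_measurable fovS.2.
  have mI : measurable_fun setT (\1_S : euclidean R ns -> R).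
    exact: measurable_indic.
  exact: (measurableT_comp mI measurable_fst).
have w01 (x : state R ns nv) : 0 <= gen_indic S x <= 1.
  by rewrite gen_indicE ler0n lern1 leq_b1.
have mdiag := @measurable_state_diag R ns nv.
have mu1 (x : state R ns nv) : mu [set x] = 0%E by exact: lebesgue_state_set1.
have onem_r_gt0 i : 0 < 1 - r i by rewrite subr_gt0; have /andP[] := r01 i.
have r_ge0 i : 0 <= r i by have /andP[] := r01 i.
set a := fun i => inner mu X (gen_indic S) (fun x => r i * p i x) / (1 - r i).
set b := fun i => inner mu X (fun x => 1 - gen_indic S x)
  (fun x => r i * p i x) / (1 - r i).
have a_ge0 i : 0 <= a i.
  apply: divr_ge0; last exact: ltW.
  exact: (inner_ge0 (pdf i)).
have b_ge0 i : 0 <= b i.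
  apply: divr_ge0; last exact: ltW.
  apply: (inner_ge0 (pdf i)) => // x.
  by rewrite subr_ge0; have /andP[] := w01 x.
(* The complementary weights give [a i + b i = r i / (1 - r i)]. *)
have onem_rM i : (1 - r i) * (1 + a i + b i) = 1.
  rewrite -addrA /a /b -mulrDl (inner_complement mX (pdf i))//.
  by rewrite mulrDr mulr1 mulrCA divff ?mulr1 ?subrK// gt_eqF.
pose C := \prod_(i < M) (1 - r i).
pose G (I : {set 'I_M} * {set 'I_M}) :=
  (\prod_(i in I.1) a i) * (\prod_(i in I.2) b i).
have G_ge0 I : 0 <= G I by rewrite mulr_ge0// prodr_ge0.
have fov_cardE n : fov_card X S f n =
    (C * \sum_(I : {set 'I_M} * {set 'I_M} | [disjoint I.1 & I.2])
      (#|I.1| == n)%:R * (\prod_(i in I.1) a i) * (\prod_(i in I.2) b i))%:E.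
  (* [u m] is the contribution of [m] objects in all, after the factorials have cancelled. *)
  pose u m := C * \sum_(I : {set 'I_M} * {set 'I_M} | [disjoint I.1 & I.2])
    (#|I.1 :|: I.2| == m)%:R * ((#|I.1| == n)%:R *
      (\prod_(i in I.1) a i) * (\prod_(i in I.2) b i)).
  rewrite /fov_card /set_integral.
  rewrite (eq_eseriesr (g := fun m => (u m)%:E)); last first.
    move=> m _.
    (* Both [fE] and the expansion of [cond_fov_card] hold on repetition-free tuples only, hence the
       passage off a null set. *)
    rewrite (@eq_integral_off_null _ _ _ (tuple_measure mu m)
      [set x | ~~ uniq x] _ _ _ _ (fun x =>
     ((\sum_(J : {set 'I_m} | #|J| == n)
        \prod_k (if k \in J then gen_indic S (tnth x k)
                 else 1 - gen_indic S (tnth x k))) *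
     (\prod_(i < M) (1 - r i) *
      \sum_(t : m.-tuple 'I_M | uniq t)
      \prod_(k < m)
        (r (tnth t k) * p (tnth t k) (tnth x k) / (1 - r (tnth t k)))))%:E)).
    - rewrite (integral_multi_bernoulli_choice mX r01 pdf mw w01) -EFinM.
      by rewrite mulrCA mulKf// pnatr_eq0 -lt0n fact_gt0.
    - exact: measurable_not_uniq mdiag _.
    - exact: tuple_measure_not_uniq mdiag mu1 _.
    - move=> x /= Xx /negP; rewrite negbK => ux.
      by rewrite cond_fov_card_uniq// fE.
  (* At most [M] components exist, so the series stops after the term of index [M]. *)
  have cardM (I : {set 'I_M} * {set 'I_M}) : (#|I.1 :|: I.2| < M.+1)%N.
    by rewrite ltnS -[leqRHS]card_ord max_card.
  rewrite (@eseries_finite _ _ M.+1) => [|m Mm]; last first.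
    rewrite /u big1 ?mulr0// => I _.
    by rewrite ltn_eqF ?mul0r// (leq_trans (cardM I)).
  by rewrite -mulr_sumr sum_nat_indic.
split=> //; split=> [n|].
  rewrite fov_cardE lee_fin mulr_ge0 ?prodr_ge0//.
    by move=> i _; exact: ltW.
  by apply: sumr_ge0 => I _; rewrite -mulrA mulr_ge0 ?ler0n//; exact: G_ge0.
under eq_eseriesr do rewrite fov_cardE.
have cardM (A : {set 'I_M}) : (#|A| < M.+1)%N.
  by rewrite ltnS -[leqRHS]card_ord max_card.
rewrite (@eseries_finite _ _ M.+1) => [|n Mn]; last first.
  rewrite big1 ?mulr0// => I _.
  by rewrite ltn_eqF ?mul0r// (leq_trans (cardM _)).
rewrite -mulr_sumr.
under eq_bigr do under eq_bigr do rewrite -mulrA.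
rewrite (sum_nat_indic (h := fun I : {set 'I_M} * {set 'I_M} => #|I.1|))//.
(* Merging [C] with the factored sum leaves a product of the factors [(1 - r i) * (1 + a i + b i)],
   each equal to 1. *)
rewrite sum_disjoint_prod -big_split big1 // => i _; exact: onem_rM.
Qed.
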